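(* For any $n\ge1$, the set of all essentially minimal $T\in\mathrm{Aut}(\mathcal{C})$ such that $(\mathcal{C},T)$ has topological rank $\le n$ is a $G_\delta$ subset of $E(\mathcal{C})$. Similarly, for any $n\ge 1$, the set of all minimal $T\in\mathrm{Aut}(\mathcal{C})$ such that $(\mathcal{C},T)$ has topological rank $\le n$ is a $G_\delta$ subset of $M(\mathcal{C})$.
   Context: $\mathcal{C}=\{0,1\}^{\mathbb{N}}$ has the product topology and metric $d_{\mathcal{C}}(x,y)=2^{-n}$ for $x\neq y$, where $n$ is least with $x(n)\ne y(n)$. $\mathrm{Aut}(\mathcal{C})$ is the Polish space of all homeomorphisms of $\mathcal{C}$ with the topology given by $d(T,S)=\sup_{x\in\mathcal{C}}d_{\mathcal{C}}(Tx,Sx)$. $E(\mathcal{C})\subseteq \mathrm{Aut}(\mathcal{C})$ is the subspace of essentially minimal homeomorphisms and $M(\mathcal{C})\subseteq\mathrm{Aut}(\mathcal{C})$ the subspace of minimal homeomorphisms. A Cantor system $(X,T)$ is a homeomorphism $T$ of a Cantor space $X$ (zero-dimensional, perfect, compact metrizable). It is minimal if every orbit is dense, and essentially minimal if it has a unique minimal set (nonempty closed set $Y$ with $TY=Y$, minimal among such sets). Systems $(X,T)$ and $(Y,S)$ are conjugate if there is a homeomorphism $\varphi:X\to Y$ with $\varphi T=S\varphi$. Topological rank: A Bratteli diagram $(V,E)$ consists of vertices $V=V_0\sqcup V_1\sqcup\cdots$ and edges $E=E_1\sqcup E_2\sqcup\cdots$, all $V_n,E_n$ finite nonempty, $V_0=\{v_0\}$,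 with maps $\mathsf{s},\mathsf{r}:E\to V$ satisfying $\mathsf{s}(E_n)=V_{n-1}$ and $\mathsf{r}(E_n)=V_n$ for $n\ge1$ (so every vertex is a source, and every vertex other than $v_0$ is a range). It is ordered if it carries a partial order $\preceq$ on $E$ in which $e,e'$ are comparable iff $\mathsf{r}(e)=\mathsf{r}(e')$. Let $X_B=\{(e_n)_{n\ge1}: e_n\in E_n,\ \mathsf{r}(e_n)=\mathsf{s}(e_{n+1})\}$ with the subspace topology of $\prod_n E_n$. The ordered diagram $B$ is essentially simple if there is a unique $x_{\max}\in X_B$ all of whose edges are $\preceq$-maximal and a unique $x_{\min}\in X_B$ all of whose edges are $\preceq$-minimal. Then the Vershik map $\lambda_B$ sends $x_{\max}$ to $x_{\min}$, and sends $(e_1,e_2,\dots)\ne x_{\max}$ to $(f_1,\dots,f_k,e_{k+1},\dots)$, where $k$ is least with $e_k$ not maximal, $f_k$ is the $\preceq$-successor of $e_k$, and $(f_1,\dots,f_{k-1})$ is the unique path of minimal edges from $v_0$ to $\mathsf{s}(f_k)$. An essentially minimal Cantor system has finite topological rank if it is conjugate to some $(X_B,\lambda_B)$ with $B$ essentially simple and $(|V_n|)_{n\ge1}$ bounded by some natural number $d$; the least possible $d$ is its topological rank. *)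

(* Defs.v *)
From HB Require Import structures.
From mathcomp Require Import all_boot all_order all_algebra.
From mathcomp Require Import all_classical all_reals all_analysis.

Set Implicit Arguments.
Unset Strict Implicit.
Unset Printing Implicit Defensive.

Import Order.TTheory GRing.Theory Num.Theory.

Local Open Scope classical_set_scope.
Local Open Scope ring_scope.

Section TopologicalDynamics.

Definition homeomorphism (X Y : topologicalType) (f : X -> Y) : Prop :=
  continuous f /\
  exists2 g : Y -> X, continuous g & cancel f g /\ cancel g f.

Definition conjugate (X Y : topologicalType) (T : X -> X) (S : Y -> Y) : Prop :=
  exists2 phi : X -> Y, homeomorphism phi & forall x, phi (T x) = S (phi x).

(* When T is bijective, iter n T y = x means y = T^-n x, so that this is the
   two-sided orbit of x. *)
Definition orbit (X : Type) (T : X -> X) (x : X) : set X :=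
  [set y | exists n, iter n T x = y \/ iter n T y = x].

Definition minimal (X : topologicalType) (T : X -> X) : Prop :=
  forall x, dense (orbit T x).

Definition closed_invariant (X : topologicalType) (T : X -> X) (Y : set X) :
    Prop :=
  [/\ Y !=set0, closed Y & T @` Y = Y].

Definition minimal_set (X : topologicalType) (T : X -> X) (Y : set X) : Prop :=
  closed_invariant T Y /\
  forall Z, closed_invariant T Z -> Z `<=` Y -> Z = Y.

Definition essentially_minimal (X : topologicalType) (T : X -> X) : Prop :=
  exists! Y, minimal_set T Y.

End TopologicalDynamics.

Section CantorDistance.
Variable R : realType.
Implicit Types x y z : cantor_space.

Definition cantor_dist x y : R :=
  if pselect (exists n, x n != y n) is left h then 2 ^- ex_minn h else 0.

Lemma cantor_distxx x : cantor_dist x x = 0.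
Proof.
rewrite /cantor_dist; case: pselect => // h.
by exfalso; case: h => n; rewrite eqxx.
Qed.

Lemma cantor_dist_sym x y : cantor_dist x y = cantor_dist y x.
Proof.
rewrite /cantor_dist; case: pselect => [h|h]; case: pselect => [h'|h'] //.
- congr (2 ^- _); case: ex_minnP => m mP mmin; case: ex_minnP => p pP pmin.
  by apply/eqP; rewrite eqn_leq mmin ?pmin // eq_sym.
- by exfalso; apply: h'; case: h => n nP; exists n; rewrite eq_sym.
- by exfalso; apply: h; case: h' => n nP; exists n; rewrite eq_sym.
Qed.

Lemma cantor_dist_ge0 x y : 0 <= cantor_dist x y.
Proof. by rewrite /cantor_dist; case: pselect. Qed.

Lemma cantor_dist_le1 x y : cantor_dist x y <= 1.
Proof.
rewrite /cantor_dist; case: pselect => // h.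
by rewrite invf_le1 ?exprn_gt0 // exprn_ege1 // ler1n.
Qed.

Lemma cantor_dist_ge x y n : x n != y n -> 2 ^- n <= cantor_dist x y.
Proof.
move=> xy; rewrite /cantor_dist; case: pselect => [h|[]]; last by exists n.
case: ex_minnP => m _ /(_ n xy) mn.
by rewrite lef_pV2 ?posrE ?exprn_gt0 // ler_weXn2l // ler1n.
Qed.

Lemma cantor_dist_eq0 x y : cantor_dist x y = 0 -> x = y.
Proof.
move=> xy0; apply: functional_extensionality_dep => n; apply/eqP.
apply: contraT => /cantor_dist_ge; rewrite xy0 leNgt => /negP[].
by rewrite invr_gt0 exprn_gt0.
Qed.

Lemma cantor_dist_triangle y x z :
  cantor_dist x z <= cantor_dist x y + cantor_dist y z.
Proof.
rewrite {1}/cantor_dist; case: pselect => [h|_]; last first.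
  by rewrite addr_ge0 ?cantor_dist_ge0.
case: ex_minnP => n xz _; have [xy|xy] := eqVneq (x n) (y n).
  rewrite xy in xz.
  by rewrite (le_trans (cantor_dist_ge xz)) // lerDr cantor_dist_ge0.
by rewrite (le_trans (cantor_dist_ge xy)) // lerDl cantor_dist_ge0.
Qed.

End CantorDistance.

(* The parameter R only fixes the real numbers in which distances are valued.
   This is a record of its own, and not a subtype of the functions on
   cantor_space, so as not to inherit the topology of pointwise convergence. *)
Record cantor_aut (R : realType) := CantorAut {
  aut_fun :> cantor_space -> cantor_space;
  aut_homeomorphism : homeomorphism aut_fun }.

HB.instance Definition _ (R : realType) := gen_eqMixin (cantor_aut R).
HB.instance Definition _ (R : realType) := gen_choiceMixin (cantor_aut R).

Section AutMetric.
Variable R : realType.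
Implicit Types T S U : cantor_aut R.

Lemma aut_ext T S : aut_fun T =1 aut_fun S -> T = S.
Proof.
case: T S => [f hf] [g hg] /= /funext fg; case: _ / fg in hg *.
by congr CantorAut; exact: Prop_irrelevance.
Qed.

Definition aut_dist T S : R := sup (range (fun x => cantor_dist R (T x) (S x))).

Lemma aut_dist_ge T S x : cantor_dist R (T x) (S x) <= aut_dist T S.
Proof.
apply: ub_le_sup; last by exists x.
by exists 1 => _ [y _ <-]; exact: cantor_dist_le1.
Qed.

Lemma aut_dist_le T S (r : R) :
  (forall x, cantor_dist R (T x) (S x) <= r) -> aut_dist T S <= r.
Proof.
move=> h; apply: ge_sup; last by move=> _ [y _ <-].
by exists (cantor_dist R (T point) (S point)); exists point.
Qed.

Lemma aut_distxx T : aut_dist T T = 0.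
Proof.
apply/eqP; rewrite eq_le; apply/andP; split.
  by apply: aut_dist_le => x; rewrite cantor_distxx.
by rewrite (le_trans _ (aut_dist_ge T T point)) // cantor_dist_ge0.
Qed.

Lemma aut_dist_eq0 T S : aut_dist T S = 0 -> T = S.
Proof.
move=> TS0; apply: aut_ext => x; apply: (@cantor_dist_eq0 R); apply/eqP.
by rewrite eq_le cantor_dist_ge0 andbT -TS0 aut_dist_ge.
Qed.

Lemma aut_dist_sym T S : aut_dist T S = aut_dist S T.
Proof.
by congr sup; apply: eq_imagel => x _; exact: cantor_dist_sym.
Qed.

Lemma aut_dist_triangle U T S : aut_dist T S <= aut_dist T U + aut_dist U S.
Proof.
apply: aut_dist_le => x.
by rewrite (le_trans (cantor_dist_triangle R (U x) _ _)) // lerD ?aut_dist_ge.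
Qed.

HB.instance Definition _ := @isMetric.Build R (cantor_aut R) aut_dist
  aut_distxx aut_dist_eq0 aut_dist_sym aut_dist_triangle.

Definition ess_minimal_aut : set (cantor_aut R) :=
  [set T | essentially_minimal T].

Definition minimal_aut : set (cantor_aut R) := [set T | minimal T].

End AutMetric.

Arguments ess_minimal_aut : clear implicits.
Arguments minimal_aut : clear implicits.

(* Level n of vert is V_n and level n of edge is E_(n+1).  Comparable edges have
   the same range, hence lie in the same level, so the partial order on E is
   given levelwise.  Nonemptiness of V_n and E_n follows from the axioms. *)
Record ordered_bratteli := OrderedBratteli {
  vert : nat -> finType;
  edge : nat -> finType;
  src : forall n, edge n -> vert n;
  rng : forall n, edge n -> vert n.+1;
  edge_le : forall n, rel (edge n);
  card_vert0 : #|vert 0| = 1%N;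
  src_surj : forall n (v : vert n), exists e : edge n, src e = v;
  rng_surj : forall n (v : vert n.+1), exists e : edge n, rng e = v;
  edge_le_refl : forall n, reflexive (@edge_le n);
  edge_le_anti : forall n, antisymmetric (@edge_le n);
  edge_le_trans : forall n, transitive (@edge_le n);
  edge_le_comparable : forall n (e f : edge n),
    (edge_le e f || edge_le f e) = (rng e == rng f) }.

Section PathSpace.
Variable B : ordered_bratteli.

Definition edge_seq : Type :=
  prod_topology (fun n => discrete_topology (edge B n)).

HB.instance Definition _ := Topological.on edge_seq.

Definition path_space : set edge_seq :=
  [set x | forall n, rng (x n : edge B n) = src (x n.+1 : edge B n.+1)].

Definition path_edge (x : path_space) (n : nat) : edge B n := \val x n.

Definition max_edge n (e : edge B n) : Prop :=
  forall f, edge_le e f -> f = e.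

Definition min_edge n (e : edge B n) : Prop :=
  forall f, edge_le f e -> f = e.

Definition succ_edge n (e f : edge B n) : Prop :=
  [/\ edge_le e f, f <> e &
      forall g, edge_le e g -> edge_le g f -> g = e \/ g = f].

Definition max_path (x : path_space) : Prop :=
  forall n, max_edge (path_edge x n).

Definition min_path (x : path_space) : Prop :=
  forall n, min_edge (path_edge x n).

Definition essentially_simple : Prop :=
  (exists! x, max_path x) /\ (exists! x, min_path x).

Definition vershik_rel (x y : path_space) : Prop :=
  (max_path x /\ min_path y) \/
  exists k, [/\ forall i, (i < k)%N -> max_edge (path_edge x i),
                ~ max_edge (path_edge x k),
                succ_edge (path_edge x k) (path_edge y k),
                forall i, (i < k)%N -> min_edge (path_edge y i) &
                forall i, (k < i)%N -> path_edge y i = path_edge x i].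

(* Only meaningful when B is essentially simple: see vershikP. *)
Definition vershik : path_space -> path_space := fun_of_rel id vershik_rel.

End PathSpace.

Arguments path_space : clear implicits.
Arguments vershik : clear implicits.

Section VershikMap.
Variable B : ordered_bratteli.
Implicit Types x y z : path_space B.

Lemma path_edgeP x n : rng (path_edge x n) = src (path_edge x n.+1).
Proof. exact: (set_mem (valP x)). Qed.

Lemma path_ext x y : (forall n, path_edge x n = path_edge y n) -> x = y.
Proof.
move=> xy; apply: val_inj.
by apply: functional_extensionality_dep => n; exact: xy.
Qed.

Lemma edge_le_total n (e f : edge B n) :
  rng e = rng f -> edge_le e f \/ edge_le f e.
Proof.
by move=> ef; apply/orP; rewrite edge_le_comparable ef eqxx.
Qed.

Lemma edge_le_rng n (e f : edge B n) : edge_le e f -> rng e = rng f.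
Proof. by move=> ef; apply/eqP; rewrite -edge_le_comparable ef. Qed.

Lemma edge_le_eq n (e f : edge B n) : edge_le e f -> edge_le f e -> e = f.
Proof. by move=> ef fe; apply: (@edge_le_anti B); rewrite ef fe. Qed.

(* A nonempty set of edges with a common range has a least element. *)
Lemma least_edge n (P : pred (edge B n)) (e0 : edge B n) : P e0 ->
  (forall e, P e -> rng e = rng e0) ->
  exists2 e, P e & forall f, P f -> edge_le e f.
Proof.
move=> Pe0 Prng.
case: (@arg_minnP _ e0 P (fun e => #|[pred f | edge_le f e]|) Pe0) => e Pe emin.
exists e => // f Pf.
have [//|fe] : edge_le e f \/ edge_le f e.
  by apply: edge_le_total; rewrite (Prng f) // Prng.
have := emin f Pf; apply: contraLR => nef; rewrite -ltnNge.
apply: proper_card; apply/properP; split.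
  by apply/fintype.subsetP => g; rewrite !inE => gf; exact: edge_le_trans gf fe.
by exists e; rewrite !inE ?edge_le_refl.
Qed.

Lemma min_edge_ex n (v : vert B n.+1) :
  exists2 e : edge B n, rng e = v & min_edge e.
Proof.
have [e0 e0v] := rng_surj v.
have [||e /eqP ev emin] := @least_edge n (fun e => rng e == v) e0.
- by rewrite e0v.
- by move=> e /eqP ->.
exists e => // f fe; apply: edge_le_eq => //; apply: emin.
by rewrite (edge_le_rng fe) ev.
Qed.

Lemma min_edge_uniq n (e f : edge B n) :
  min_edge e -> min_edge f -> rng e = rng f -> e = f.
Proof.
by move=> em fm /edge_le_total[ef|fe]; [exact: fm|rewrite (em f)].
Qed.

Lemma succ_edge_ex n (e : edge B n) : ~ max_edge e -> exists f, succ_edge e f.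
Proof.
move=> /existsNP[f0 /not_implyP[ef0 /eqP f0e]].
have [||f /andP[ef fe] fmin] :=
    @least_edge n (fun f => edge_le e f && (f != e)) f0.
- by rewrite ef0.
- by move=> f /andP[/edge_le_rng <- _]; rewrite (edge_le_rng ef0).
exists f; split=> //; first exact/eqP.
move=> g eg gf; have [->|ge] := eqVneq g e; [by left|right].
by apply: edge_le_eq => //; apply: fmin; rewrite eg.
Qed.

Lemma succ_edge_uniq n (e f g : edge B n) :
  succ_edge e f -> succ_edge e g -> f = g.
Proof.
move=> [ef fe fS] [eg ge gS].
have [fg|gf] : edge_le f g \/ edge_le g f.
  by apply: edge_le_total; rewrite -(edge_le_rng ef) (edge_le_rng eg).
- by case: (gS f ef fg).
- by case: (fS g eg gf) => // ->.
Qed.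

(* A path starting at level k extends to a path from v_0 by minimal edges. *)
Lemma min_extension k (x : forall n, edge B n) :
    (forall i, (k <= i)%N -> rng (x i) = src (x i.+1)) ->
  exists y : path_space B,
    (forall i, (i < k)%N -> min_edge (path_edge y i)) /\
    (forall i, (k <= i)%N -> path_edge y i = x i).
Proof.
elim: k x => [|k IH] x xP.
  by exists (exist _ (x : edge_seq B) (mem_set (fun n => xP n (leq0n n)))).
have [e ev emin] := min_edge_ex (src (x k.+1)).
pose x' := @dfwith nat (fun n => edge B n) x k e.
have x'k : x' k = e by exact: dfwith_in.
have x'i i : i != k -> x' i = x i.
  by move=> ik; apply: dfwith_out; rewrite eq_sym.
have [|y [ymin yx]] := IH x'.
  move=> i; rewrite leq_eqVlt => /orP[/eqP<-|ki].
    by rewrite x'k x'i ?ev // gtn_eqF.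
  by rewrite !x'i ?xP // gtn_eqF // ltnW.
exists y; split=> i.
  rewrite ltnS leq_eqVlt => /orP[/eqP->|]; last exact: ymin.
  by rewrite yx // x'k.
by move=> ki; rewrite yx ?(ltnW ki) // x'i // gtn_eqF.
Qed.

Lemma vershik_rel_uniq x y z :
  essentially_simple B -> vershik_rel x y -> vershik_rel x z -> y = z.
Proof.
move=> [_ [xm [_ xmP]]].
move=> [[xmax ymin]|[k [xk nxk yk yl yr]]] [[xmax' zmin]|[l [xl nxl zl zm zr]]].
- by rewrite -(xmP y) // -(xmP z).
- by have := xmax l.
- by have := xmax' k.
have kl : k = l.
  case: (ltngtP k l) => // [kl|lk]; first by have := xl _ kl.
  by have := xk _ lk.
rewrite -{l}kl in xl nxl zl zm zr.
have yzk : path_edge y k = path_edge z k by exact: succ_edge_uniq yk zl.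
have below d : (d <= k)%N -> path_edge y (k - d) = path_edge z (k - d).
  elim: d => [|d IH dk]; first by rewrite subn0.
  have kd : (k - d = (k - d.+1).+1)%N by rewrite subnSK.
  have lt : (k - d.+1 < k)%N by rewrite -{2}(subnK dk) addnS ltnS leq_addr.
  apply: min_edge_uniq; [exact: yl|exact: zm|].
  by rewrite !path_edgeP -kd IH // ltnW.
apply: path_ext => n; case: (ltngtP n k) => [nk|kn|->//].
  by rewrite -(subKn (ltnW nk)) below // leq_subr.
by rewrite yr // zr.
Qed.

Lemma vershik_rel_ex x : essentially_simple B -> exists y, vershik_rel x y.
Proof.
move=> [_ [xm [xmP _]]].
have [xmax|/existsNP nmax] := pselect (max_path x).
  by exists xm; left.
have exk : exists k, `[< ~ max_edge (path_edge x k) >].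
  by case: nmax => k kP; exists k; apply/asboolP.
case: (ex_minnP exk) => k /asboolP kP kmin.
have [f fS] := succ_edge_ex kP.
pose x' := @dfwith nat (fun n => edge B n) (path_edge x) k f.
have x'k : x' k = f by exact: dfwith_in.
have x'i i : i != k -> x' i = path_edge x i.
  by move=> ik; apply: dfwith_out; rewrite eq_sym.
have [|y [ymin yx]] := @min_extension k x'.
  move=> i; rewrite leq_eqVlt => /orP[/eqP<-|ki].
    rewrite x'k x'i ?gtn_eqF // -path_edgeP.
    by case: fS => /edge_le_rng ->.
  by rewrite !x'i ?path_edgeP // gtn_eqF // ltnW.
exists y; right; exists k; split=> //.
- move=> i ik; apply: contrapT => nm.
  have /kmin : `[< ~ max_edge (path_edge x i) >] by exact/asboolP.
  by rewrite leqNgt ik.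
- by rewrite yx // x'k.
- by move=> i ki; rewrite yx ?(ltnW ki) // x'i // gtn_eqF.
Qed.

Lemma vershikP x y :
  essentially_simple B -> vershik_rel x y <-> vershik B x = y.
Proof.
move=> Bs; have [z xz] := vershik_rel_ex x Bs.
have -> : vershik B x = z.
  by apply: xget_unique => // y' xy'; exact: vershik_rel_uniq Bs xy' xz.
by split=> [xy|<-//]; exact: vershik_rel_uniq Bs xz xy.
Qed.

End VershikMap.

Section TopologicalRank.
Variables (X : topologicalType) (T : X -> X).

Definition rank_bounded_by (d : nat) : Prop :=
  exists B : ordered_bratteli,
    [/\ essentially_simple B,
        forall n, (#|vert B n.+1| <= d)%N &
        conjugate T (vershik B)].

Definition topological_rank (d : nat) : Prop :=
  rank_bounded_by d /\ forall d', rank_bounded_by d' -> (d <= d')%N.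

Definition topological_rank_le (n : nat) : Prop :=
  exists2 d, topological_rank d & (d <= n)%N.

End TopologicalRank.

(* Main.v *)
(* A homeomorphism T of the Cantor space has topological rank at most n if and
   only if, for every m, it admits a clopen Kakutani-Rokhlin partition with at
   most n towers whose floors, and whose base, agree on the first m coordinates.
   A partition that works for T works verbatim for every S uniformly close to T,
   so the condition at a fixed m is open, and the conjunction over m is G_delta
   in any space of homeomorphisms.

   For a Bratteli-Vershik system, the finite paths ending at level N give such
   partitions.  Conversely, such partitions can be made to refine one another
   with decreasing bases: if the base of a very fine partition lies at height j
   of the previous one, pull the fine partition back by T^j.  The nested
   sequence is then the path space of a diagram with the towers as vertices. *)
Require Import Defs.
From mathcomp Require Import all_boot all_order all_algebra.
From mathcomp Require Import all_classical all_reals all_analysis.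
From mathcomp Require Import borel_hierarchy.

Local Open Scope classical_set_scope.

Set Implicit Arguments.
Unset Strict Implicit.
Unset Printing Implicit Defensive.

Import Order.TTheory GRing.Theory Num.Theory.

(** * Cylinders and compactness *)

(** Dependent sequences, so that it applies both to points of the Cantor space and to edge sequences
    of a diagram. *)
Definition agree (A : nat -> Type) k (x y : forall i, A i) :=
  forall i, (i < k)%N -> x i = y i.

Lemma agree_sym (A : nat -> Type) k (x y : forall i, A i) :
  agree k x y -> agree k y x.
Proof. by move=> xy i ik; rewrite xy. Qed.

Lemma agree_trans (A : nat -> Type) k (y x z : forall i, A i) :
  agree k x y -> agree k y z -> agree k x z.
Proof. by move=> xy yz i ik; rewrite xy // yz. Qed.

Lemma agree_le (A : nat -> Type) k l (x y : forall i, A i) :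
  (k <= l)%N -> agree l x y -> agree k x y.
Proof. by move=> kl xy i ik; apply: xy; exact: leq_trans kl. Qed.

Section Cylinders.
Variable K : nat -> topologicalType.
Hypothesis nbhsK : forall n (a : K n), \forall b \near a, b = a.
Implicit Types x y : prod_topology K.

Lemma nbhs_agree x k : nbhs x [set y | agree k x y].
Proof.
elim: k => [|k IH]; first by apply: filterE => y i.
have xk : nbhs x [set y | y k = x k].
  exact: (@proj_continuous nat K k x _ (nbhsK (x k))).
apply: filterS2 IH xk => y IH xk i.
by rewrite ltnS leq_eqVlt => /orP[/eqP->|]; [rewrite xk|exact: IH].
Qed.

(** The product topology is a supremum of initial topologies, so it suffices that cylinders refine
    sets read off one coordinate [i]; length [i.+1] does. *)
Lemma near_agreeP x (P : set (prod_topology K)) :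
  (\forall y \near x, P y) <-> exists k, forall y, agree k x y -> P y.
Proof.
split=> [|[k kP]]; last first.
  exact: (@filterS _ _ (nbhs_filter x) _ _ kP (nbhs_agree x k)).
have cylF : Filter (filter_from [set: nat] (fun k => [set y | agree k x y])).
  apply: filter_from_filter; first by exists 0%N.
  move=> i j _ _; exists (maxn i j) => // y xy.
  by split; apply: agree_le xy; rewrite ?leq_maxl ?leq_maxr.
suff : filter_from [set: nat] (fun k => [set y | agree k x y]) --> x.
  by move=> + xP => /(_ P xP) [k _ kP]; exists k.
apply/cvg_sup => i U [_ [[W oW <-] Wx WU]].
exists i.+1 => // y xy; apply: WU => /=.
by move: Wx => /=; rewrite /proj (xy i).
Qed.

End Cylinders.
Lemma near_cantorP (x : cantor_space) (P : set cantor_space) :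
  (\forall y \near x, P y) <-> exists k, forall y, agree k x y -> P y.
Proof.
apply: (@near_agreeP (fun=> bool)) => _ a; exact: (discrete_set1 a).
Qed.

Lemma near_pathP B (x : path_space B) (P : set (path_space B)) :
  (\forall y \near x, P y) <->
  exists k, forall y, agree k (path_edge x) (path_edge y) -> P y.
Proof.
have nE := @near_agreeP (fun n => discrete_topology (edge B n)).
have nedge n (a : discrete_topology (edge B n)) : \forall b \near a, b = a.
  exact: (discrete_set1 a).
split.
  move=> [_ [[W oW <-] Wx WP]].
  have /nE[//|k kW] : nbhs (\val x : edge_seq B) W by exact: open_nbhs_nbhs.
  by exists k => y xy; apply: WP; exact: kW.
move=> [k kP].
have xk : nbhs (\val x : edge_seq B) [set y | agree k (\val x) y].
  by apply/nE => //; exists k.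
have := @initial_continuous _ _ (@set_val _ (path_space B)) x _ xk.
exact: (@filterS _ (nbhs x) (nbhs_filter x) _ P kP).
Qed.

(** Compactness in its near-covering form, along the filter of large [n]. *)
Lemma cantor_cover (P : nat -> set cantor_space) :
    (forall x, exists k, forall n y, (k <= n)%N -> agree k x y -> P n y) ->
  exists n, forall x, P n x.
Proof.
move=> Pnear.
have := cantor_space_compact.
rewrite compact_near_coveringP => /(_ nat \oo P) [x _|n _ nP]; last first.
  by exists n => x; apply: (nP n) => //=.
have [k kP] := Pnear x.
exists ([set y | agree k x y], [set n | (k <= n)%N]) => /=.
  split; last by exists k.
  by apply/near_cantorP; exists k.
by move=> [y n] /= [xy kn]; exact: kP.
Qed.

(** Were the intersection empty, the complements would satisfy [cantor_cover] and some [F n] would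
    be empty. *)
Lemma cantor_nested (F : nat -> set cantor_space) :
    (forall n, F n !=set0) -> (forall n, F n.+1 `<=` F n) ->
    (forall n, exists k, forall x y, agree k x y -> F n x -> F n y) ->
  exists x, forall n, F n x.
Proof.
move=> F0 Fdec Floc; apply: contrapT => /forallNP noF.
have {}Fdec m n : (m <= n)%N -> F n `<=` F m.
  by move=> /subnK <-; elim: (n - m)%N => // d IH x /Fdec; exact: IH.
have [x|n nF] := @cantor_cover (fun n => ~` F n); last first.
  by have [x /nF] := F0 n.
have /existsNP[m mF] := noF x; have [k kF] := Floc m.
exists (maxn m k) => n y; rewrite geq_max => /andP[mn kn] xy yF.
apply: mF; apply: kF (Fdec _ _ mn _ yF).
by apply: agree_sym; exact: agree_le (leq_maxr _ _) xy.
Qed.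

(** A Lebesgue number argument: points close to [x] are related to [x], hence to each other, and
    compactness makes the closeness uniform. *)
Lemma uniform_modulus (E : cantor_space -> cantor_space -> Prop) :
    (forall x y, E x y -> E y x) ->
    (forall x y z, E x y -> E y z -> E x z) ->
    (forall x, exists k, forall y, agree k x y -> E x y) ->
  exists k, forall x y, agree k x y -> E x y.
Proof.
move=> Esym Etrans Eloc.
apply: (@cantor_cover (fun k x => forall y, agree k x y -> E x y)) => x.
have [k kE] := Eloc x; exists k => n y kn xy z yz.
apply: Etrans (Esym _ _ (kE _ xy)) (kE _ _).
by apply: agree_trans xy _; exact: agree_le yz.
Qed.

Lemma continuous_modulus (f : cantor_space -> cantor_space) m :
  continuous f -> exists k, forall x y, agree k x y -> agree m (f x) (f y).
Proof.
move=> fC; apply: uniform_modulus => [x y|x y z|x]; first exact: agree_sym.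
  exact: agree_trans.
apply/(near_cantorP x (fun y => agree m (f x) (f y))).
by apply: fC; apply/near_cantorP; exists m.
Qed.
(** * Kakutani-Rokhlin partitions *)

(* The floor of x is (tower x, level x).  Towers may be empty, so that
   'I_n accounts for "at most n towers". *)
Record castle n := Castle {
  tower : cantor_space -> 'I_n;
  level : cantor_space -> nat;
  height : 'I_n -> nat;
  castle_modulus : exists k, forall x y,
    agree k x y -> tower x = tower y /\ level x = level y;
  level_lt : forall x, (level x < height (tower x))%N }.

Definition same_floor n (D : castle n) (x y : cantor_space) :=
  tower D x = tower D y /\ level D x = level D y.

(** For bijective [T], each floor is mapped onto the next one and the union of the top floors onto
    the base. *)
Definition climbs n (T : cantor_space -> cantor_space) (D : castle n) :=
  forall x, ((level D x).+1 = height D (tower D x) /\ level D (T x) = 0%N) \/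
    (tower D (T x) = tower D x /\ level D (T x) = (level D x).+1).

(** The second clause makes the base small across all towers at once; it later forces a unique
    minimal path. *)
Definition fine n m (D : castle n) :=
  (forall x y, same_floor D x y -> agree m x y) /\
  (forall x y, level D x = 0%N -> level D y = 0%N -> agree m x y).

Definition approximable n m (T : cantor_space -> cantor_space) :=
  exists D : castle n, climbs T D /\ fine m D.

(** * Openness of approximability *)

Lemma aut_dist_agree (R : realType) (T S : cantor_aut R) k x :
  (aut_dist T S < 2 ^- k)%R -> agree k (T x) (S x).
Proof.
move=> TS i ik; apply/eqP; apply: contraTT TS => /(@cantor_dist_ge R) TSi.
rewrite -leNgt (le_trans _ (aut_dist_ge T S x)) // (le_trans _ TSi) //.
by rewrite lef_pV2 ?posrE ?exprn_gt0 // ler_weXn2l ?ler1n // ltnW.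
Qed.

(** Climbing depends on [T x] only through its floor, which is unchanged when [T x] is replaced by a
    point agreeing with it on [k] coordinates, [k] being the modulus of the castle. *)
Lemma approximable_open (R : realType) n m :
  open [set T : cantor_aut R | approximable n m T].
Proof.
rewrite openE => T [D [TD Dm]].
have [k kD] := castle_modulus D.
apply/nbhs_ballP; exists (2 ^- k)%R => [|S] /=.
  by rewrite invr_gt0 exprn_gt0.
rewrite ballEmdist /= => TS; exists D; split=> // x.
have [-> ->] := kD _ _ (agree_sym (aut_dist_agree x TS)).
exact: TD.
Qed.

Lemma approximable_Gdelta (R : realType) n (A : set (cantor_aut R)) :
  Gdelta [set T : A | forall m, approximable n m (\val T)].
Proof.
exists (fun m => [set T : A | approximable n m (\val T)]) => [m|].
  exact: (open_comp (fun x _ => @initial_continuous _ _ _ x)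
    (@approximable_open R n m)).
by apply/seteqP; split=> [T TA m _|T TA m]; exact: TA.
Qed.
(** * From diagrams to castles *)

Section PathCount.
Variable B : ordered_bratteli.
Implicit Types x y : path_space B.

(** The number of paths from v_0 to a vertex; it becomes the height of a tower. *)
Fixpoint path_count n : vert B n -> nat :=
  if n is n'.+1 return vert B n -> nat then
    fun v => (\sum_(e : edge B n' | rng e == v) path_count (src e))%N
  else fun=> 1%N.

Definition edge_lt n (e f : edge B n) := edge_le e f && (e != f).

(** The number of paths from v_0 to [rng e] whose last edge precedes [e]. *)
Definition edge_rank n (e : edge B n) :=
  (\sum_(f : edge B n | edge_lt f e) path_count (src f))%N.

(* The number of paths from v_0 to the vertex of x at level n that precede
   x in the Vershik order, that is, compared first on their last edges. *)
Definition path_rank n x := (\sum_(i < n) edge_rank (path_edge x i))%N.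

Lemma path_rankS n x :
  path_rank n.+1 x = (path_rank n x + edge_rank (path_edge x n))%N.
Proof. by rewrite /path_rank big_ord_recr. Qed.

Lemma path_count_gt0 n (v : vert B n) : (0 < path_count v)%N.
Proof.
elim: n v => [//|n IH] v /=.
have [e ev] := rng_surj v.
by rewrite (bigD1 e) /= ?ev // ltn_addr.
Qed.

Lemma edge_ltNge n (e f : edge B n) :
  rng e = rng f -> edge_lt e f = ~~ edge_le f e.
Proof.
move=> ef; rewrite /edge_lt; have [fe|fe] /= := boolP (edge_le f e).
  by apply/negP => /andP[ef' /eqP]; apply; exact: edge_le_eq.
case: (edge_le_total ef) => [->|fe']; last by rewrite fe' in fe.
by apply: contraNneq fe => ->; exact: edge_le_refl.
Qed.

(** The sum for [f] contains all terms of the sum for [e], and the term of [e] itself. *)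
Lemma edge_rank_lt n (e f : edge B n) : edge_lt e f ->
  (edge_rank e + path_count (src e) <= edge_rank f)%N.
Proof.
move=> ef; rewrite [leqRHS](bigD1 e) //= addnC leq_add2l.
rewrite [leqLHS]big_mkcond [leqRHS]big_mkcond /=; apply: leq_sum => g _.
case: ifP => // ge; case: ifP => //.
move: ge ef => /andP[ge neq] /andP[ef _].
rewrite neq andbT /edge_lt (edge_le_trans ge ef) /= => /negbFE/eqP gf.
by move: neq; rewrite (edge_le_eq ge) ?eqxx // gf.
Qed.

Lemma edge_rank_count n (e : edge B n) :
  (edge_rank e + path_count (src e) <= path_count (rng e))%N.
Proof.
rewrite [leqRHS]/= (bigD1 e) //= addnC leq_add2l.
rewrite [leqLHS]big_mkcond [leqRHS]big_mkcond /=; apply: leq_sum => g _.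
by case: ifP => // /andP[/edge_le_rng -> ->]; rewrite eqxx.
Qed.

Lemma edge_rank_succ n (e f : edge B n) : succ_edge e f ->
  edge_rank f = (edge_rank e + path_count (src e))%N.
Proof.
move=> [ef fe fS]; rewrite /edge_rank (bigD1 e) /=; last first.
  by rewrite /edge_lt ef eq_sym; apply/eqP.
rewrite addnC; congr addn; apply: eq_bigl => g; apply/idP/idP.
  move=> /andP[/andP[gf gnf] gne]; rewrite /edge_lt gne andbT.
  have [//|eg] : edge_le g e \/ edge_le e g.
    by apply: edge_le_total; rewrite (edge_le_rng gf) (edge_le_rng ef).
  by case: (fS g eg gf) => gE; rewrite gE eqxx in gne gnf.
move=> /andP[ge gne]; rewrite gne andbT /edge_lt (edge_le_trans ge ef) /=.
apply: contraNneq gne => gf; apply/eqP.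
by apply: edge_le_eq => //; rewrite gf.
Qed.

Lemma edge_rank_max n (e : edge B n) : max_edge e ->
  path_count (rng e) = (edge_rank e + path_count (src e))%N.
Proof.
move=> emax; rewrite /edge_rank /= (bigD1 e) //= addnC; congr addn.
apply: eq_bigl => g; rewrite /edge_lt andbC [in RHS]andbC; case: eqP => //= ge.
apply/idP/idP => [/eqP gr|/edge_le_rng ->//].
by case: (edge_le_total gr) => // /emax.
Qed.

Lemma edge_rank_min n (e : edge B n) : min_edge e <-> edge_rank e = 0%N.
Proof.
split=> [emin|/eqP].
  by rewrite /edge_rank big1 // => f /andP[/emin ->]; rewrite eqxx.
rewrite sum_nat_eq0 => /forallP e0 f fe; apply/eqP; apply: contraT => nfe.
have := implyP (e0 f); rewrite /edge_lt fe nfe => /(_ isT).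
by rewrite eqn0Ngt path_count_gt0.
Qed.

Lemma path_rank_lt n x : (path_rank n x < path_count (src (path_edge x n)))%N.
Proof.
elim: n => [|n IH]; first by rewrite /path_rank big_ord0.
rewrite path_rankS -path_edgeP (leq_trans _ (edge_rank_count _)) //.
by rewrite addnC ltn_add2l.
Qed.

(** Paths with last edge [e] have ranks in an interval of length [path_count (src e)] starting at
    [edge_rank e]. These intervals are disjoint for distinct edges into one vertex, so the rank
    determines the last edge, then the earlier ones. *)
Lemma path_rank_inj n x y :
  src (path_edge x n) = src (path_edge y n) -> path_rank n x = path_rank n y ->
  agree n (path_edge x) (path_edge y).
Proof.
elim: n => [|n IH]; first by move=> _ _ i.
rewrite -!path_edgeP !path_rankS => xy rxy.
have nlt u v : (path_rank n u + edge_rank (path_edge u n) =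
    path_rank n v + edge_rank (path_edge v n))%N ->
    ~~ edge_lt (path_edge u n) (path_edge v n).
  move=> uv; apply/negP => /edge_rank_lt; apply/negP; rewrite -ltnNge.
  rewrite (leq_ltn_trans (leq_addl (path_rank n v) _)) // -uv addnC.
  by rewrite ltn_add2l path_rank_lt.
have exy : path_edge x n = path_edge y n.
  apply: edge_le_eq; rewrite -[edge_le _ _]negbK -edge_ltNge ?nlt //.
have {}IH : agree n (path_edge x) (path_edge y).
  by apply: IH; [rewrite exy|move: rxy; rewrite exy => /addIn].
by move=> i; rewrite ltnS leq_eqVlt => /orP[/eqP->|/IH].
Qed.

Lemma path_rank_eq0 n x :
  path_rank n x = 0%N <-> forall i, (i < n)%N -> min_edge (path_edge x i).
Proof.
split=> [/eqP|xmin].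
  rewrite sum_nat_eq0 => /forallP x0 i ik.
  by apply/edge_rank_min/eqP; exact: (x0 (Ordinal ik)).
by rewrite /path_rank big1 // => i _; apply/edge_rank_min; exact: xmin.
Qed.

Lemma path_rank_max n x : (forall i, (i < n)%N -> max_edge (path_edge x i)) ->
  (path_rank n x).+1 = path_count (src (path_edge x n)).
Proof.
elim: n => [|n IH] xmax.
  by rewrite /path_rank big_ord0.
rewrite path_rankS -path_edgeP (edge_rank_max (xmax n (ltnSn n))) -IH.
  by rewrite addnS addnC.
by move=> i ik; apply: xmax; exact: ltnW.
Qed.

(** The Vershik map adds one with carry: a change at an index at least [n] resets the first [n]
    edges, and a change below [n] raises the rank by one. *)
Lemma path_rank_vershik n x y : vershik_rel x y ->
  (path_rank n x).+1 = path_count (src (path_edge x n)) /\ path_rank n y = 0%N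
  \/ src (path_edge y n) = src (path_edge x n) /\
     path_rank n y = (path_rank n x).+1.
Proof.
move=> [[xmax ymin]|[k [xk _ yk ymin yx]]].
  by left; split; [apply: path_rank_max|apply/path_rank_eq0].
have [nk|kn] := leqP n k.
  left; split; [apply: path_rank_max|apply/path_rank_eq0] => i ik.
    by apply: xk; exact: leq_trans nk.
  by apply: ymin; exact: leq_trans nk.
right; rewrite yx //; split=> //.
elim: n kn => // n IH; rewrite ltnS leq_eqVlt => /orP[/eqP kn|kn]; last first.
  by rewrite !path_rankS yx // IH.
(* At the changed edge, the [path_rank k x] given up below is one less than the [path_count] gained
   by passing to the successor. *)
rewrite -{n IH}kn !path_rankS (edge_rank_succ yk).
have -> : path_rank k y = 0%N by apply/path_rank_eq0.
by rewrite -(path_rank_max xk) addnS add0n addnC.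
Qed.

End PathCount.

(** * Castles from a coding by paths *)

Section DiagramToCastle.
Variables (B : ordered_bratteli) (phi : cantor_space -> path_space B).
Variable psi : path_space B -> cantor_space.
Hypotheses (phiC : continuous phi) (psiC : continuous psi).
Hypothesis phiK : cancel phi psi.
Let path x := path_edge (phi x).

Lemma path_modulus N :
  exists k, forall x y, agree k x y -> agree N (path x) (path y).
Proof.
apply: uniform_modulus => [x y|x y z|x]; first exact: agree_sym.
  exact: agree_trans.
apply/(near_cantorP x (fun y => agree N (path x) (path y))).
have pN : \forall p \near phi x, agree N (path x) (path_edge p).
  by apply/near_pathP; exists N.
exact: phiC pN.
Qed.

(** Uniform continuity of [psi] on the image of [phi], by compactness of the Cantor space. *)
Lemma path_separation m :
  exists N, forall x y, agree N (path x) (path y) -> agree m x y.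
Proof.
apply: (@cantor_cover
  (fun N x => forall y, agree N (path x) (path y) -> agree m x y)).
move=> x; have xm : \forall y \near psi (phi x), agree m x y.
  by rewrite phiK; apply/near_cantorP; exists m.
have /near_pathP[N NP] : \forall p \near phi x, agree m x (psi p) := psiC xm.
have [k kN] := path_modulus N.
exists (maxn N k) => i y; rewrite geq_max => /andP[Ni ki] xy z yz.
have xyN : agree N (path x) (path y).
  by apply: kN; apply: agree_le xy; exact: leq_maxr.
have xzN : agree N (path x) (path z).
  by apply: agree_trans xyN _; exact: agree_le yz.
rewrite -[y]phiK -[z]phiK; apply: agree_trans (NP _ xzN).
by apply: agree_sym; exact: NP.
Qed.

(** Away from the unique minimal path, some edge is not minimal, and it stays so nearby; by
    compactness, paths with many minimal initial edges are close to the minimal path. *)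
Lemma min_path_separation m : (exists! p, @min_path B p) ->
  exists N, forall x y, (forall i, (i < N)%N -> min_edge (path x i)) ->
    (forall i, (i < N)%N -> min_edge (path y i)) -> agree m x y.
Proof.
move=> [p [pmin puniq]].
suff [N NP] : exists N, forall x,
    (forall i, (i < N)%N -> min_edge (path x i)) -> agree m (psi p) x.
  exists N => x y xmin ymin; apply: agree_trans (NP _ ymin).
  by apply: agree_sym; exact: NP.
apply: (@cantor_cover (fun N x =>
  (forall i, (i < N)%N -> min_edge (path x i)) -> agree m (psi p) x)).
move=> x; have [xmin|/existsNP[j jmin]] := pselect (min_path (phi x)).
  by exists m => N y _ xy _; rewrite (puniq _ xmin) phiK.
have [k kj] := path_modulus j.+1.
exists (maxn j.+1 k) => N y; rewrite geq_max => /andP[jN kN] xy ymin.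
case: jmin; have := ymin j jN; rewrite -(kj x y) //.
by apply: agree_le xy; exact: leq_maxr.
Qed.

Variables (n N : nat).
Hypothesis card_le : (#|vert B N.+1| <= n)%N.

Let label (v : vert B N.+1) : 'I_n := widen_ord card_le (enum_rank v).

Let label_inj : injective label.
Proof. by move=> u v /(congr1 val)/= /val_inj/enum_rank_inj. Qed.

(** The sum has at most one term; it extends [path_count] by zero to the labels of empty towers. *)
Let label_height (i : 'I_n) := (\sum_(v | label v == i) path_count v)%N.

Let label_heightE v : label_height (label v) = path_count v.
Proof.
rewrite /label_height (big_pred1 v) // => u.
by rewrite /= (inj_eq label_inj).
Qed.

Let end_label x := label (src (path x N.+1)).

Let castle_modulus : exists k, forall x y, agree k x y ->
  end_label x = end_label y /\ path_rank N.+1 (phi x) = path_rank N.+1 (phi y).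
Proof.
have [k kP] := path_modulus N.+2; exists k => x y /kP xy.
rewrite /end_label xy //; split=> //; apply: eq_bigr => i _.
by rewrite -/(path x) xy // (ltn_trans (ltn_ord i)).
Qed.

Let level_lt x :
  (path_rank N.+1 (phi x) < label_height (end_label x))%N.
Proof. by rewrite label_heightE path_rank_lt. Qed.

Definition path_castle := Castle castle_modulus level_lt.

Lemma path_castle_climbs T : (forall x, vershik_rel (phi x) (phi (T x))) ->
  climbs T path_castle.
Proof.
move=> TP x; have [[xH Tx]|[e r]] := path_rank_vershik N.+1 (TP x).
  by left; rewrite /= label_heightE.
by right; rewrite /= /end_label /path e.
Qed.

Lemma path_castle_floor x y :
  same_floor path_castle x y -> agree N.+1 (path x) (path y).
Proof. by move=> [/label_inj xy rxy]; exact: path_rank_inj. Qed.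

Lemma path_castle_base x : level path_castle x = 0%N ->
  forall i, (i < N.+1)%N -> min_edge (path x i).
Proof. by move/path_rank_eq0. Qed.

End DiagramToCastle.

Lemma rank_bounded_approximable (T : cantor_space -> cantor_space) n m :
  rank_bounded_by T n -> approximable n m T.
Proof.
move=> [B [Bs Bn [phi [phiC [psi psiC [phiK psiK]]] phiT]]].
have [N NP] := path_separation phiC psiC phiK m.
have [M MP] := min_path_separation phiC phiK m Bs.2.
(* The castle reads [(maxn N M).+1] edges, enough for both separation levels; the successor is there
   because the vertex bound starts at V_1. *)
exists (path_castle phiC (Bn (maxn N M))); split.
  by apply: path_castle_climbs => x; apply/(vershikP _ _ Bs).
split=> [x y /path_castle_floor xy|x y].
  by apply: NP; apply: agree_le xy; rewrite ltnW // ltnS leq_maxl.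
move=> /path_castle_base xmin /path_castle_base ymin.
have iNM i : (i < M)%N -> (i < (maxn N M).+1)%N.
  by move=> iM; rewrite ltnW // ltnS (leq_trans iM) // leq_maxr.
by apply: MP => i /iNM; [exact: xmin|exact: ymin].
Qed.
(** * From castles to diagrams *)

Lemma iter_cancel (X : Type) (f g : X -> X) d :
  cancel f g -> cancel (iter d f) (iter d g).
Proof. by move=> fK; elim: d => // d IH x; rewrite iterSr /= fK IH. Qed.

Definition refines n (D E : castle n) :=
  (forall x y, same_floor E x y -> same_floor D x y) /\
  (forall x, level E x = 0%N -> level D x = 0%N).

(** * Moving up and down a tower *)

Section Climbing.
Variables (n : nat) (T g : cantor_space -> cantor_space).
Hypothesis gK : cancel g T.
Variable D : castle n.
Hypothesis TD : climbs T D.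

Lemma level_top x :
  level D (T x) = 0%N <-> (level D x).+1 = height D (tower D x).
Proof.
have [[-> ->]//|[tT lT]] := TD x; rewrite lT; split=> // lx.
by have := level_lt D (T x); rewrite tT lT lx ltnn.
Qed.

Lemma level_next x : level D (T x) <> 0%N ->
  tower D (T x) = tower D x /\ level D (T x) = (level D x).+1.
Proof. by have [[]|] := TD x. Qed.

Lemma ascend d z : (level D z + d < height D (tower D z))%N ->
  tower D (iter d T z) = tower D z /\
  level D (iter d T z) = (level D z + d)%N.
Proof.
elim: d => [|d IH]; first by rewrite addn0.
rewrite addnS => zd; have [/= tz lz] := IH (ltnW zd).
have [|-> ->] := @level_next (iter d T z); last by rewrite tz lz.
by move=> /level_top; rewrite tz lz => zE; rewrite zE ltnn in zd.
Qed.

Lemma descend d x : (d <= level D x)%N ->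
  tower D (iter d g x) = tower D x /\
  level D (iter d g x) = (level D x - d)%N.
Proof.
elim: d => [|d IH]; first by rewrite subn0.
move=> dx; have [/= tx lx] := IH (ltnW dx).
have := @level_next (g (iter d g x)); rewrite gK tx lx subnS => -[|-> ->//].
by apply/eqP; rewrite subn_eq0 -ltnNge.
Qed.

Definition base x := iter (level D x) g x.

Lemma baseP x : tower D (base x) = tower D x /\ level D (base x) = 0%N.
Proof. by have [|-> ->] := @descend (level D x) x; rewrite ?subnn. Qed.

End Climbing.

Lemma iter_modulus (f : cantor_space -> cantor_space) h m : continuous f ->
  exists k, forall j x y, (j <= h)%N -> agree k x y ->
    agree m (iter j f x) (iter j f y).
Proof.
move=> fC; elim: h => [|h [k kP]].
  by exists m => j x y; rewrite leqn0 => /eqP ->.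
have [l lP] := continuous_modulus k fC.
exists (maxn l m) => -[|j] x y.
  by move=> _; exact: agree_le (leq_maxr _ _).
rewrite ltnS !iterSr => jh xy; apply: kP => //; apply: lP.
by apply: agree_le xy; exact: leq_maxl.
Qed.

(** * Construction of a refining sequence of castles *)

Section Refinement.
Variables (n : nat) (T g : cantor_space -> cantor_space).
Hypotheses (TC : continuous T) (gC : continuous g).
Hypotheses (TK : cancel T g) (gK : cancel g T).

(** The floors are pulled back by T^j, which commutes with [T]. *)
Lemma shift_castle (D : castle n) j : climbs T D ->
  exists E : castle n, [/\ climbs T E,
    forall x, tower E x = tower D (iter j T x) &
    forall x, level E x = level D (iter j T x)].
Proof.
move=> TD.
have Emod : exists k, forall x y, agree k x y ->
    tower D (iter j T x) = tower D (iter j T y) /\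
    level D (iter j T x) = level D (iter j T y).
  have [k kD] := castle_modulus D; have [l lP] := iter_modulus j k TC.
  by exists l => x y /lP xy; apply: kD; exact: xy.
exists (Castle Emod (fun x => level_lt D (iter j T x))).
by split=> // x; have := TD (iter j T x); rewrite -iterS iterSr.
Qed.

(* The base of a fine castle F lies in a single floor, of level j say, of D;
   pulling F back by T^j moves its base into the base of D. *)
Lemma refine_castle (D : castle n) m : climbs T D ->
    (forall k, approximable n k T) ->
  exists E : castle n, [/\ climbs T E, fine m E & refines D E].
Proof.
move=> TD Tapp; have [k kD] := castle_modulus D.
(* The shift [j] depends on [F], which is chosen after [K]; so [K] must serve all [j] up to the
   largest height of [D]. *)
have [K KP] := iter_modulus (\max_i height D i)%N (maxn k m) gC.
have [F [TF [Ffloor Fbase]]] := Tapp (maxn K k).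
pose z := base g F point; have [_ z0] := baseP gK TF point.
pose j := level D z.
have jh : (j <= \max_i height D i)%N.
  by apply: leq_trans (ltnW (level_lt D z)) (leq_bigmax _).
have [E [TE tE lE]] := shift_castle j TF.
have back x y : agree K (iter j T x) (iter j T y) -> agree (maxn k m) x y.
  by move=> /(KP j _ _ jh); rewrite !(iter_cancel j TK).
have Efloor x y : same_floor E x y -> agree (maxn k m) x y.
  rewrite /same_floor !tE !lE => xy; apply: back.
  by apply: agree_le (Ffloor _ _ xy); exact: leq_maxl.
exists E; split=> //; [split|split] => x.
- by move=> y /Efloor; apply: agree_le; exact: leq_maxr.
- move=> y; rewrite !lE => x0 y0; apply: (@agree_le _ _ (maxn k m)).
    exact: leq_maxr.
  by apply: back; apply: agree_le (Fbase _ _ x0 y0); exact: leq_maxl.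
- by move=> y /Efloor xy; apply: kD; apply: agree_le xy; exact: leq_maxl.
(* Here T^j x lies in the base of [F], hence in the floor of [z], at level [j] of [D]; going down
   [j] floors brings [x] to level 0. *)
- rewrite lE => x0.
  have lx : level D (iter j T x) = j.
    have [|_ <-//] := kD z (iter j T x).
    by apply: agree_le (Fbase _ _ z0 x0); exact: leq_maxr.
  have [|_] := @descend _ _ _ gK D TD j (iter j T x); first by rewrite lx.
  by rewrite lx subnn (iter_cancel j TK).
Qed.

(** Dependent choice along [refine_castle], started at one tower of height one so that the diagram
    has a single vertex at level 0. *)
Lemma nested_castles : (0 < n)%N -> (forall k, approximable n k T) ->
  exists D : nat -> castle n,
    [/\ forall x y, tower (D 0%N) x = tower (D 0%N) y,
        forall x, level (D 0%N) x = 0%N,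
        forall k, climbs T (D k),
        forall k, refines (D k) (D k.+1) &
        forall k, fine k (D k.+1)].
Proof.
move=> n0 Tapp.
have D0mod : exists k, forall x y : cantor_space, agree k x y ->
    Ordinal n0 = Ordinal n0 /\ 0%N = 0%N by exists 0%N.
pose D0 := @Castle n (fun=> Ordinal n0) (fun=> 0%N) (fun=> 1%N)
  D0mod (fun=> ltnSn 0).
have TD0 : climbs T D0 by left.
pose next k (D : {D | climbs T D}) : {D | climbs T D} :=
  let: exist E (And3 TE _ _) := cid (refine_castle k (svalP D) Tapp) in
  exist _ E TE.
pose D k := iteri k next (exist _ D0 TD0).
have DS k : fine k (sval (D k.+1)) /\ refines (sval (D k)) (sval (D k.+1)).
  by rewrite /D /= /next; case: cid => E [].
exists (fun k => sval (D k)); split=> // k; first exact: svalP.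
  by case: (DS k).
by case: (DS k).
Qed.

End Refinement.

(** * The ordered diagram of a nested sequence of castles *)

Section NestedCastles.
Variables (n : nat) (T g : cantor_space -> cantor_space).
Hypotheses (TK : cancel T g) (gK : cancel g T).
Variable D : nat -> castle n.
Hypothesis tower0 : forall x y, tower (D 0%N) x = tower (D 0%N) y.
Hypothesis level0 : forall x, level (D 0%N) x = 0%N.
Hypothesis TD : forall k, climbs T (D k).
Hypothesis Dref : forall k, refines (D k) (D k.+1).
Hypothesis Dfine : forall k, fine k (D k.+1).

Local Notation tow k := (tower (D k)).
Local Notation lev k := (level (D k)).
Local Notation bas k := (base g (D k)).

Lemma floor_le k l x y : (k <= l)%N ->
  same_floor (D l) x y -> same_floor (D k) x y.
Proof.
move=> /subnK <-; elim: (l - k)%N => // d IH xy.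
by apply: IH; exact: (Dref _).1 xy.
Qed.

Lemma level_eq0_le k l x : (k <= l)%N -> lev l x = 0%N -> lev k x = 0%N.
Proof.
move=> /subnK <-; elim: (l - k)%N => // d IH x0.
by apply: IH; exact: (Dref _).2 x0.
Qed.

Lemma base_tower k x : tow k (bas k x) = tow k x.
Proof. by have [] := baseP gK (TD k) x. Qed.

Lemma base_level k x : lev k (bas k x) = 0%N.
Proof. by have [] := baseP gK (TD k) x. Qed.

(** Going down [lev k.+1 x] floors reaches the base of [D k.+1], hence of [D k]; were [lev k x]
    larger, a positive level of [D k] would remain. *)
Lemma level_leS k x : (lev k x <= lev k.+1 x)%N.
Proof.
rewrite leqNgt; apply/negP => lx.
have [|_] := @descend _ _ _ gK _ (TD k) (lev k.+1 x) x; first exact: ltnW.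
have -> : level (D k) (iter (lev k.+1 x) g x) = 0%N.
  by apply: (Dref k).2; exact: base_level.
by apply/eqP; rewrite eq_sym subn_eq0 -ltnNge.
Qed.

Lemma base_towerS k x : tow k.+1 (bas k x) = tow k.+1 x.
Proof. by have [] := descend gK (TD k.+1) (level_leS k x). Qed.

Lemma base_levelS k x : lev k.+1 (bas k x) = (lev k.+1 x - lev k x)%N.
Proof. by have [] := descend gK (TD k.+1) (level_leS k x). Qed.

(** Empty towers are discarded, since every vertex must be the source of an edge. *)
Definition castle_vert k : finType :=
  {i : 'I_n | `[< exists x, tow k x = i >]}.

Definition vert_of k x : castle_vert k :=
  exist _ (tow k x) (introT (asboolP _) (ex_intro _ x erefl)).

Lemma vert_of_surj k (v : castle_vert k) : exists x, vert_of k x = v.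
Proof. by have /asboolP[x xv] := valP v; exists x; apply: val_inj. Qed.

Lemma vert_ofP k x y : vert_of k x = vert_of k y <-> tow k x = tow k y.
Proof. by split=> [/(congr1 val)//|xy]; apply: val_inj. Qed.

(** A common bound on levels makes the floors a finite type. *)
Let bound k := (\max_i height (D k) i)%N.

Lemma level_lt_bound k x : (lev k x < (bound k).+1)%N.
Proof. by rewrite ltnW // ltnS (leq_trans (level_lt _ _)) // leq_bigmax. Qed.

Definition floor_of k x : 'I_n * 'I_(bound k).+1 :=
  (tow k x, Ordinal (level_lt_bound k x)).

Lemma floor_ofP k x y : floor_of k x = floor_of k y <-> same_floor (D k) x y.
Proof.
split=> [[tE lE]|[tE lE]]; first by split.
by congr pair => //; exact: val_inj.
Qed.

(* An edge at level k is a floor of D k.+1 contained in the base of D k. *)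
Definition castle_edge k : finType :=
  {e : 'I_n * 'I_(bound k.+1).+1 |
    `[< exists2 z, lev k z = 0%N & floor_of k.+1 z = e >]}.

(* The edge crossed by x: the floor of D k.+1 that contains the point at the
   bottom of the D k tower of x. *)
Definition edge_of k x : castle_edge k :=
  exist _ (floor_of k.+1 (bas k x))
    (introT (asboolP _) (ex_intro2 _ _ (bas k x) (base_level k x) erefl)).

Lemma edge_point k (e : castle_edge k) :
  {z | lev k z = 0%N & floor_of k.+1 z = val e}.
Proof. exact/cid2/asboolP/(valP e). Qed.

Definition point_of k (e : castle_edge k) := s2val (edge_point e).

Lemma point_of_level k (e : castle_edge k) : lev k (point_of e) = 0%N.
Proof. exact: (s2valP (edge_point e)). Qed.

Lemma point_of_floor k (e : castle_edge k) :
  floor_of k.+1 (point_of e) = val e.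
Proof. exact: (s2valP' (edge_point e)). Qed.

Lemma edgeP k (e f : castle_edge k) :
  same_floor (D k.+1) (point_of e) (point_of f) <-> e = f.
Proof.
rewrite -floor_ofP !point_of_floor; split=> [|->//].
exact: val_inj.
Qed.

Lemma point_edge_floor k x :
  same_floor (D k.+1) (point_of (edge_of k x)) (bas k x).
Proof. by apply/floor_ofP; rewrite point_of_floor. Qed.

Lemma point_edge_towerS k x : tow k.+1 (point_of (edge_of k x)) = tow k.+1 x.
Proof. by have [-> _] := point_edge_floor k x; exact: base_towerS. Qed.

Lemma point_edge_levelS k x :
  lev k.+1 (point_of (edge_of k x)) = (lev k.+1 x - lev k x)%N.
Proof. by have [_ ->] := point_edge_floor k x; exact: base_levelS. Qed.

Lemma point_edge_tower k x : tow k (point_of (edge_of k x)) = tow k x.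
Proof.
have [-> _] := (Dref k).1 _ _ (point_edge_floor k x); exact: base_tower.
Qed.

(** The bottom of the [D k] tower of [x] lies in the [D k.+1] tower of [x], exactly [lev k x] floors
    below [x]. *)
Lemma edge_ofP k (e : castle_edge k) x :
  e = edge_of k x <->
  tow k.+1 (point_of e) = tow k.+1 x /\
  lev k.+1 (point_of e) = (lev k.+1 x - lev k x)%N.
Proof.
by rewrite -edgeP /same_floor point_edge_towerS point_edge_levelS.
Qed.

Definition castle_src k (e : castle_edge k) := vert_of k (point_of e).

Definition castle_rng k (e : castle_edge k) := vert_of k.+1 (point_of e).

(** The order in which a tower of [D k.+1] passes through the base of [D k]. *)
Definition castle_le k : rel (castle_edge k) := fun e f =>
  (tow k.+1 (point_of e) == tow k.+1 (point_of f)) &&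
  (lev k.+1 (point_of e) <= lev k.+1 (point_of f))%N.

Lemma card_castle_vert k : (#|castle_vert k| <= n)%N.
Proof. by rewrite card_sig (leq_trans (max_card _)) // card_ord. Qed.

Lemma card_castle_vert0 : #|castle_vert 0| = 1%N.
Proof.
apply/eqP/fintype1P; exists (vert_of 0 point) => v.
by have [x <-] := vert_of_surj v; apply/vert_ofP.
Qed.

Lemma castle_src_surj k (v : castle_vert k) : exists e, castle_src e = v.
Proof.
have [x <-] := vert_of_surj v; exists (edge_of k x).
by apply/vert_ofP; exact: point_edge_tower.
Qed.

Lemma castle_rng_surj k (v : castle_vert k.+1) :
  exists e : castle_edge k, castle_rng e = v.
Proof.
have [x <-] := vert_of_surj v; exists (edge_of k x).
by apply/vert_ofP; exact: point_edge_towerS.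
Qed.

Lemma castle_le_refl k : reflexive (@castle_le k).
Proof. by move=> e; rewrite /castle_le eqxx leqnn. Qed.

Lemma castle_le_anti k : antisymmetric (@castle_le k).
Proof.
move=> e f /andP[/andP[/eqP ef le_ef] /andP[_ le_fe]].
by apply/edgeP; split=> //; apply/eqP; rewrite eqn_leq; apply/andP.
Qed.

Lemma castle_le_trans k : transitive (@castle_le k).
Proof.
move=> f e h /andP[/eqP ef le_ef] /andP[/eqP fh le_fh].
by rewrite /castle_le ef fh eqxx (leq_trans le_ef).
Qed.

Lemma castle_le_comparable k (e f : castle_edge k) :
  (castle_le e f || castle_le f e) = (castle_rng e == castle_rng f).
Proof.
rewrite /castle_le [X in _ || X && _]eq_sym -andb_orr leq_total andbT.
by apply/eqP/eqP => [/vert_ofP|/vert_ofP].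
Qed.

Definition castle_diagram : ordered_bratteli :=
  @OrderedBratteli castle_vert castle_edge castle_src castle_rng castle_le
    card_castle_vert0 castle_src_surj castle_rng_surj castle_le_refl
    castle_le_anti castle_le_trans castle_le_comparable.

Let B := castle_diagram.

(** * Coding of points by paths, and its conjugacy with the Vershik map *)

Lemma edge_of_path x : path_space B (fun k => edge_of k x).
Proof.
move=> k; apply/vert_ofP.
by rewrite point_edge_towerS point_edge_tower.
Qed.

Definition path_of x : path_space B :=
  exist _ ((fun k => edge_of k x) : edge_seq B) (mem_set (edge_of_path x)).

Lemma path_of_edge x k : path_edge (path_of x) k = edge_of k x.
Proof. by []. Qed.

Lemma edge_of_floor k x y :
  same_floor (D k.+1) x y -> edge_of k x = edge_of k y.
Proof.
move=> xy; apply/edge_ofP; rewrite point_edge_towerS point_edge_levelS.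
have [_ lxy] := (Dref k).1 _ _ xy; have [txy lxyS] := xy.
by rewrite txy lxyS lxy.
Qed.

(** Each edge records the tower at level [k.+1] and the increment of the level from [k] to [k.+1],
    so floors are recovered inductively from the trivial castle. *)
Lemma agree_floor k x y :
  agree k (path_edge (path_of x)) (path_edge (path_of y)) ->
  same_floor (D k) x y.
Proof.
elim: k => [|k IH] xy; first by split; [exact: tower0|rewrite !level0].
have [_ lxy] := IH (agree_le (leqnSn k) xy).
have /edge_ofP := xy k (ltnSn k).
rewrite path_of_edge point_edge_towerS point_edge_levelS => -[txy dxy].
split=> //; have := level_leS k x; have := level_leS k y.
rewrite -lxy => /subnK <- /subnK <-.
by rewrite dxy lxy.
Qed.

Lemma floor_agree k x y : same_floor (D k) x y ->
  agree k (path_edge (path_of x)) (path_edge (path_of y)).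
Proof.
by move=> xy i ik; apply: edge_of_floor; exact: floor_le xy.
Qed.

Lemma path_of_continuous : continuous path_of.
Proof.
move=> x P /near_pathP[k kP]; have [l lD] := castle_modulus (D k).
apply/near_cantorP; exists l => y xy.
by apply: kP; apply: floor_agree; exact: lD.
Qed.

Lemma path_of_fine k x y :
  agree k.+1 (path_edge (path_of x)) (path_edge (path_of y)) -> agree k x y.
Proof. by move=> /agree_floor; exact: (Dfine k).1. Qed.

(** Given [x] with the first [k] edges, a point [z] of the next edge lies at the base of the [D k]
    tower of [x]. Climbing [lev k x] floors from [z] reaches the floor of [x], which keeps those
    edges and adds the new one. *)
Lemma path_prefix (p : path_space B) k :
  exists x, agree k (path_edge (path_of x)) (path_edge p).
Proof.
elim: k => [|k [x xp]]; first by exists point.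
pose z := point_of (path_edge p k : castle_edge k).
have zx : tow k z = tow k x.
  rewrite /z; case: k xp @z => [|k] xp z; first exact: tower0.
  have /vert_ofP <- := path_edgeP p k.
  by rewrite -xp // path_of_edge point_edge_towerS.
have z0 : lev k z = 0%N := point_of_level _.
have [|tz lz] := @ascend _ _ _ (TD k) (lev k x) z.
  by rewrite z0 zx; exact: level_lt.
rewrite z0 zx add0n in tz lz.
exists (iter (lev k x) T z) => i; rewrite ltnS leq_eqVlt => /orP[/eqP ->|ik].
  rewrite path_of_edge; apply/edgeP.
  have := point_edge_floor k (iter (lev k x) T z).
  by rewrite /base lz (iter_cancel _ TK).
by rewrite -xp // !path_of_edge; apply: edge_of_floor; apply: floor_le ik _.
Qed.

Lemma path_of_surj p : exists x, path_of x = p.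
Proof.
have [k|k x xp||x xp] := @cantor_nested
  (fun k x => agree k (path_edge (path_of x)) (path_edge p)).
- exact: path_prefix.
- exact: agree_le xp.
- move=> k; have [l lD] := castle_modulus (D k); exists l => x y xy.
  by apply: agree_trans; apply/agree_sym/floor_agree; exact: lD.
- by exists x; apply: path_ext => k; exact: (xp k.+1).
Qed.

(** Surjectivity provides an inverse by choice; [path_of_fine] gives both its continuity and the
    injectivity of the coding. *)
Lemma path_of_homeomorphism : homeomorphism path_of.
Proof.
split; first exact: path_of_continuous.
pose psi p := sval (cid (path_of_surj p)).
have psiK : cancel psi path_of by move=> p; exact: svalP (cid (path_of_surj p)).
exists psi; last split=> // x.
  move=> p P /near_cantorP[k kP]; apply/near_pathP; exists k.+1 => q pq.
  by apply: kP; apply: path_of_fine; rewrite !psiK.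
apply: functional_extensionality_dep => i.
by apply: (@path_of_fine i.+1); rewrite ?psiK.
Qed.

(** A tower of [D k.+1] does not meet the base of [D k] between [bas k x] and [x] except at
    [bas k x], since levels of [D k] drop by one at each step down. *)
Lemma edge_of_between k (e : castle_edge k) x :
    tow k.+1 (point_of e) = tow k.+1 x ->
    (lev k.+1 x - lev k x <= lev k.+1 (point_of e) <= lev k.+1 x)%N ->
  e = edge_of k x.
Proof.
move=> te /andP[le_x le_e]; apply/edge_ofP; split=> //.
pose d := (lev k.+1 x - lev k.+1 (point_of e))%N.
have dx : (d <= lev k x)%N by rewrite leq_subLR addnC -leq_subLR.
have [|tz lz] := @descend _ _ _ gK _ (TD k.+1) d x; first exact: leq_subr.
have [_ l0] : same_floor (D k) (iter d g x) (point_of e).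
  by apply: (Dref k).1; split; [rewrite tz|rewrite lz subKn].
have [_ ld] := descend gK (TD k) dx.
have xd : d = lev k x.
  apply/eqP; rewrite eqn_leq dx -subn_eq0.
  by move: ld; rewrite l0 point_of_level => <-.
by rewrite -xd subKn.
Qed.

Lemma edge_of_max k x : lev k.+1 (T x) = 0%N ->
  max_edge (edge_of k x : edge B k).
Proof.
move=> /(level_top (TD k.+1)) xtop f /andP[/eqP].
rewrite point_edge_towerS point_edge_levelS => tf lf.
apply: edge_of_between => //; rewrite lf /= -ltnS xtop tf.
exact: level_lt.
Qed.

Lemma edge_of_min k x : lev k x = 0%N ->
  min_edge (edge_of k x : edge B k) <-> lev k.+1 x = 0%N.
Proof.
move=> x0; split=> [xmin|x0S f /andP[/eqP]].
  (* The bottom floor of the [D k.+1] tower of [x] is itself an edge, below the one of [x]. *)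
  have := xmin (edge_of k (bas k.+1 x)); rewrite /= /castle_le.
  have b0 : lev k (bas k.+1 x) = 0%N by apply: (Dref k).2; exact: base_level.
  rewrite !point_edge_towerS !point_edge_levelS base_tower base_level eqxx /=.
  move=> /(_ isT)/edge_ofP; rewrite point_edge_levelS base_level x0 subn0.
  by case=> _ <-.
rewrite point_edge_towerS point_edge_levelS x0S leqn0 => tf /eqP lf.
by apply/edge_ofP; rewrite lf x0S.
Qed.

(** [T x] starts a new passage through a tower of [D k] inside the same tower of [D k.+1], so the
    two edges are consecutive visits to the base of [D k]. *)
Lemma edge_of_succ k x : lev k (T x) = 0%N -> lev k.+1 (T x) <> 0%N ->
  succ_edge (edge_of k x : edge B k) (edge_of k (T x)).
Proof.
move=> Tx0 /(level_next (TD k.+1))[tT lT].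
have tE f : castle_le (edge_of k x) f -> tow k.+1 (point_of f) = tow k.+1 x.
  by move=> /andP[/eqP <- _]; exact: point_edge_towerS.
split=> [||f xf /andP[_]].
- rewrite /= /castle_le !point_edge_towerS !point_edge_levelS Tx0 tT lT.
  by rewrite eqxx subn0 /= (leq_trans (leq_subr _ _)).
- move=> /edge_ofP; rewrite point_edge_levelS Tx0 subn0 lT => -[_ /esym].
  by move=> e; have := leq_subr (lev k x) (lev k.+1 x); rewrite e ltnn.
rewrite point_edge_levelS Tx0 subn0 lT leq_eqVlt => /orP[/eqP lf|lf].
  right; apply/edge_ofP; rewrite Tx0 subn0 lT lf; split=> //.
  by rewrite tT; exact: tE.
left; apply: edge_of_between; first exact: tE.
by apply/andP; split=> //; move: xf => /andP[_]; rewrite point_edge_levelS.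
Qed.

Lemma edge_of_next k x : lev k (T x) <> 0%N -> edge_of k (T x) = edge_of k x.
Proof.
move=> Tx; have TxS : lev k.+1 (T x) <> 0%N by move=> /((Dref k).2 _).
have [_ lT] := level_next (TD k) Tx; have [tTS lTS] := level_next (TD k.+1) TxS.
apply/edge_ofP; rewrite point_edge_towerS point_edge_levelS lT lTS.
by rewrite subSS.
Qed.

(** If [T x] lies in every base, a maximal path goes to a minimal one. Otherwise the first castle
    whose base misses [T x] locates the edge that moves to its successor. *)
Lemma path_of_vershik x : vershik_rel (path_of x) (path_of (T x)).
Proof.
have [Tx|/existsNP[k0 Tx]] := pselect (forall k, lev k (T x) = 0%N).
  left; split=> k; first exact/edge_of_max.
  by apply/edge_of_min.
have exk : exists k, lev k (T x) != 0%N by exists k0; apply/eqP.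
(* The first such castle has positive index by [level0]; when it is [D k.+1], the edge that changes
   is the one at [k]. *)
right; case: (ex_minnP exk) => -[|k] /eqP kP kmin.
  by rewrite level0 in kP.
have low i : (i <= k)%N -> lev i (T x) = 0%N.
  by move=> ik; apply: contrapT => /eqP/kmin; rewrite leqNgt ltnS ik.
have xs := edge_of_succ (low k (leqnn k)) kP.
exists k; split=> //.
- by move=> i ik; exact/edge_of_max/low.
- by case: xs => xT Tne _ /(_ _ xT).
- by move=> i ik; apply/edge_of_min; apply: low => //; exact: ltnW.
by move=> i ki; apply: edge_of_next => /(level_eq0_le ki).
Qed.

Lemma min_path_of x : min_path (path_of x) <-> forall k, lev k x = 0%N.
Proof.
split=> [xmin k|x0 k]; last exact/edge_of_min.
by elim: k => [|k IH]; [exact: level0|apply/edge_of_min => //; exact: xmin].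
Qed.

(** The bases are nested, nonempty and clopen, and the second clause of [fine] shrinks them to a
    point. *)
Lemma nested_base_point :
  exists x0, forall x, (forall k, lev k x = 0%N) <-> x = x0.
Proof.
have [|||x0 x00] := @cantor_nested (fun k x => lev k x = 0%N).
- by move=> k; exists (bas k point); exact: base_level.
- by move=> k x; exact: (Dref k).2.
- by move=> k; have [l lD] := castle_modulus (D k); exists l => x y /lD[_ ->].
exists x0 => x; split=> [xl|->//].
apply: functional_extensionality_dep => i.
by apply: ((Dfine i.+1).2 x x0 _ _ i); rewrite ?xl ?x00.
Qed.

(** The minimal path codes the common point [x0] of the bases, and the maximal one codes its
    preimage [g x0]: a maximal path has no edge to increase, so its Vershik image is minimal. *)
Lemma castle_diagram_simple : essentially_simple B.
Proof.
have [x0 x0P] := nested_base_point; have x00 := (x0P x0).2 erefl.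
split.
  exists (path_of (g x0)); split=> [k|p].
    by apply: edge_of_max; rewrite gK.
  have [x <-] := path_of_surj p => xmax.
  have [[_ /min_path_of/x0P Tx]|[k [_ nmax]]] := path_of_vershik x.
    by rewrite -Tx TK.
  by case: nmax; exact: xmax.
exists (path_of x0); split; first exact/min_path_of.
by move=> p; have [x <-] := path_of_surj p => /min_path_of/x0P ->.
Qed.

Lemma castle_diagram_rank : rank_bounded_by T n.
Proof.
exists B; split; first exact: castle_diagram_simple.
  by move=> k; exact: card_castle_vert.
exists path_of; first exact: path_of_homeomorphism.
move=> x; apply/esym/vershikP; first exact: castle_diagram_simple.
exact: path_of_vershik.
Qed.

End NestedCastles.

Lemma approximable_rank_bounded (T : cantor_space -> cantor_space) n :
  (0 < n)%N -> homeomorphism T -> (forall m, approximable n m T) ->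
  rank_bounded_by T n.
Proof.
move=> n0 [TC [g gC [TK gK]]] Tapp.
have [D [t0 l0 TD Dref Dfine]] := nested_castles TC gC TK gK n0 Tapp.
exact: (castle_diagram_rank TK gK t0 l0 TD Dref Dfine).
Qed.

(** * Rank bounds as countable intersections of open conditions *)

Lemma topological_rank_leE (X : topologicalType) (T : X -> X) n :
  topological_rank_le T n <-> rank_bounded_by T n.
Proof.
split=> [[d [[B [Bs Bd BT]] _] dn]|Tn].
  by exists B; split=> // k; exact: leq_trans dn.
have exd : exists d, `[< rank_bounded_by T d >] by exists n; apply/asboolP.
case: (ex_minnP exd) => d /asboolP dT dmin.
exists d; last by apply: dmin; apply/asboolP.
by split=> // d' d'T; apply: dmin; apply/asboolP.
Qed.

(** Stated for an arbitrary subspace [A], so that both halves of the theorem are instances. *)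
Lemma topological_rank_le_Gdelta (R : realType) n (A : set (cantor_aut R)) :
  (0 < n)%N -> Gdelta [set T : A | topological_rank_le (\val T) n].
Proof.
move=> n0; suff -> : [set T : A | topological_rank_le (\val T) n] =
    [set T : A | forall m, approximable n m (\val T)].
  exact: approximable_Gdelta.
apply/seteqP; split=> T /= => [/topological_rank_leE Tn m|Tn].
  exact: rank_bounded_approximable.
apply/topological_rank_leE/approximable_rank_bounded => //.
exact: aut_homeomorphism.
Qed.

Theorem corollary3p4 (R : realType) (n : nat) (hn : (1 <= n)%N) :
  Gdelta [set T : ess_minimal_aut R | topological_rank_le (\val T) n] /\
  Gdelta [set T : minimal_aut R | topological_rank_le (\val T) n].
Proof. by split; exact: topological_rank_le_Gdelta. Qed.
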